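(* Assume that SDP has finite optimal value. Let $\mathrm{val}$ be any real number satisfying $\mathrm{val} < \langle C, I\rangle$, and consider the problem $$(\mathrm{P}_{\mathrm{val}})\qquad \max\ \lambda_{\min}(X)\quad \text{s.t.}\quad \mathcal{A}(X)=b,\ \ \langle C, X\rangle = \mathrm{val},\quad X\in\mathbb{S}^{n\times n}.$$ If $X^*$ is an optimal solution of $(\mathrm{P}_{\mathrm{val}})$, then $Z(X^* )$ is an optimal solution of SDP. Conversely, if $Z^*$ is an optimal solution of SDP, then $$X^* := I + \frac{\langle C, I\rangle - \mathrm{val}}{\langle C, I\rangle - \mathrm{opt\_val}}\,(Z^*-I)$$ is an optimal solution of $(\mathrm{P}_{\mathrm{val}})$, and $Z^* = Z(X^* )$.
   Context: $\mathbb{S}^{n\times n}$ is the space of real symmetric $n\times n$ matrices with trace inner product $\langle U,V\rangle=\mathrm{tr}(UV)$. Let $C,A_1,\dots,A_m\in\mathbb{S}^{n\times n}$, $b\in\mathbb{R}^m$, $\mathcal{A}(X):=(\langle A_1,X\rangle,\dots,\langle A_m,X\rangle)$. SDP denotes the problem $\inf \langle C,X\rangle$ subject to $\mathcal{A}(X)=b$, $X\succeq 0$ (positive semidefinite), and $\mathrm{opt\_val}$ is its optimal value. Standing assumptions: the identity matrix $I$ is feasible for SDP, i.e. $\mathcal{A}(I)=b$; and $C$ is not orthogonal to the nullspace of $\mathcal{A}$ (so not every feasible point is optimal). $\lambda_{\min}(X)$ is the smallest eigenvalue of $X$. For $X\in\mathbb{S}^{n\times n}$ with $\lambda_{\min}(X)<1$,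 define $$Z(X):=I+\frac{1}{1-\lambda_{\min}(X)}(X-I),$$ the point where the ray from $I$ in direction $X-I$ meets the boundary of the positive semidefinite cone. (When SDP has finite optimal value, every $X$ with $\mathcal{A}(X)=b$ and $\langle C,X\rangle<\langle C,I\rangle$ has $\lambda_{\min}(X)<1$, so $Z(X)$ is defined.) *)

(* Defs.v *)
From mathcomp Require Import all_boot all_order all_algebra.
From mathcomp Require Import all_classical all_reals all_analysis.

Set Implicit Arguments.
Unset Strict Implicit.
Unset Printing Implicit Defensive.

Import Order.TTheory GRing.Theory Num.Theory.
Local Open Scope classical_set_scope.
Local Open Scope ring_scope.

Definition mxinner (R : realType) (n : nat) (U V : 'M[R]_n) : R :=
  \tr (U *m V).

Definition psdmx (R : realType) (n : nat) (X : 'M[R]_n) : Prop :=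
  X \is symmetricmx /\ forall u : 'cV[R]_n, 0 <= (u^T *m X *m u) 0 0.

(* A real symmetric matrix of size n > 0 has a nonempty finite set of real
   eigenvalues, so the infimum is then a minimum. *)
Definition lambda_min (R : realType) (n : nat) (X : 'M[R]_n) : R :=
  inf [set a : R | eigenvalue X a].

Definition Amap (R : realType) (n m : nat) (A : 'I_m -> 'M[R]_n)
    (X : 'M[R]_n) : 'rV[R]_m :=
  \row_(i < m) mxinner (A i) X.

Definition sdp_feasible (R : realType) (n m : nat) (A : 'I_m -> 'M[R]_n)
    (b : 'rV[R]_m) (X : 'M[R]_n) : Prop :=
  Amap A X = b /\ psdmx X.

Definition opt_val (R : realType) (n m : nat) (C : 'M[R]_n)
    (A : 'I_m -> 'M[R]_n) (b : 'rV[R]_m) : \bar R :=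
  ereal_inf [set (mxinner C X)%:E | X in [set X | sdp_feasible A b X]].

Definition sdp_optimal (R : realType) (n m : nat) (C : 'M[R]_n)
    (A : 'I_m -> 'M[R]_n) (b : 'rV[R]_m) (X : 'M[R]_n) : Prop :=
  sdp_feasible A b X /\
  forall Y : 'M[R]_n, sdp_feasible A b Y -> mxinner C X <= mxinner C Y.

Definition Pval_feasible (R : realType) (n m : nat) (C : 'M[R]_n)
    (A : 'I_m -> 'M[R]_n) (b : 'rV[R]_m) (val : R) (X : 'M[R]_n) : Prop :=
  [/\ X \is symmetricmx, Amap A X = b & mxinner C X = val].

Definition Pval_optimal (R : realType) (n m : nat) (C : 'M[R]_n)
    (A : 'I_m -> 'M[R]_n) (b : 'rV[R]_m) (val : R) (X : 'M[R]_n) : Prop :=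
  Pval_feasible C A b val X /\
  forall Y : 'M[R]_n, Pval_feasible C A b val Y ->
    lambda_min Y <= lambda_min X.

(* Only meaningful when [lambda_min X < 1]. *)
Definition Zmap (R : realType) (n : nat) (X : 'M[R]_n) : 'M[R]_n :=
  1%:M + (1 - lambda_min X)^-1 *: (X - 1%:M).

(* Main.v *)
Require Import Defs.
From mathcomp Require Import all_boot all_order all_algebra.
From mathcomp Require Import all_classical all_reals all_analysis.
From mathcomp Require Import ring lra.

(** Seen from I, the smallest eigenvalue and the objective are both affine on
    rays: for s > 0 the point I + s (X - I) has smallest eigenvalue
    1 - s (1 - lambda_min X) ([lambda_min_ray]) and objective value
    c - s (c - C(X)), where c = C(I) ([mxinner_ray]). Feasible points of the
    semidefinite program are the symmetric X in the affine space with
    0 <= lambda_min X, and those of P_val are the X in the same affine space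
    with c - C(X) = c - val. Along a ray, both problems therefore compare the
    single scale-invariant ratio (c - C(X)) / (1 - lambda_min X): the first
    normalizes by lambda_min = 0, where the ray leaves the cone, and maximizes
    the numerator; the second fixes the numerator and minimizes the
    denominator. A better point of one problem is rescaled along its ray
    into a better point of the other.

    Rescaling is legitimate because two degenerate cases do not occur: a point
    below c in objective has lambda_min < 1, as otherwise the program would be
    unbounded ([lambda_min_lt1]), and the optimal value is strictly below c
    ([feasible_descent]).

    The analytic input is that, for symmetric X, the matrix X - t I is positive
    semidefinite exactly when t <= lambda_min X ([psdmx_lambda_min]). *)

Set Implicit Arguments.
Unset Strict Implicit.

Import Order.TTheory GRing.Theory Num.Theory.
Local Open Scope classical_set_scope.
Local Open Scope ring_scope.

(** * Symmetric matrices and quadratic forms *)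

Definition bform {R : realType} {n : nat} (S : 'M[R]_n) (u v : 'cV[R]_n) : R :=
  (u^T *m S *m v) 0 0.

Lemma symmetricmxP {R : realType} {n : nat} (X : 'M[R]_n) :
  X \is symmetricmx <-> X^T = X.
Proof.
split=> [/is_hermitianmxP|XT].
  by rewrite expr0 scale1r map_mx_id.
by apply/is_hermitianmxP; rewrite expr0 scale1r map_mx_id.
Qed.

Lemma symmetricmx_affine {R : realType} {n : nat} (s t : R) (X : 'M[R]_n) :
  X \is symmetricmx -> t%:M + s *: X \is symmetricmx.
Proof.
move=> /symmetricmxP sX; apply/symmetricmxP.
by rewrite linearD linearZ /= tr_scalar_mx sX.
Qed.

Lemma bformDS {R : realType} {n : nat} (S T : 'M[R]_n) u v :
  bform (S + T) u v = bform S u v + bform T u v.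
Proof. by rewrite /bform mulmxDr mulmxDl mxE. Qed.

Lemma bformZS {R : realType} {n : nat} a (S : 'M[R]_n) u v :
  bform (a *: S) u v = a * bform S u v.
Proof. by rewrite /bform -scalemxAr -scalemxAl mxE. Qed.

Lemma bform_scalar {R : realType} {n : nat} a (u v : 'cV[R]_n) :
  bform a%:M u v = a * bform 1%:M u v.
Proof. by rewrite -bformZS scalemx1. Qed.

Lemma bform_shift {R : realType} {n : nat} (S : 'M[R]_n) t u v :
  bform (S - t%:M) u v = bform S u v - t * bform 1%:M u v.
Proof. by rewrite bformDS -scaleN1r bformZS mulN1r bform_scalar. Qed.

Lemma bformDl {R : realType} {n : nat} (S : 'M[R]_n) u1 u2 v :
  bform S (u1 + u2) v = bform S u1 v + bform S u2 v.
Proof. by rewrite /bform linearD /= !mulmxDl mxE. Qed.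

Lemma bformDr {R : realType} {n : nat} (S : 'M[R]_n) u v1 v2 :
  bform S u (v1 + v2) = bform S u v1 + bform S u v2.
Proof. by rewrite /bform mulmxDr mxE. Qed.

Lemma bformZl {R : realType} {n : nat} a (S : 'M[R]_n) u v :
  bform S (a *: u) v = a * bform S u v.
Proof. by rewrite /bform linearZ /= -!scalemxAl mxE. Qed.

Lemma bformZr {R : realType} {n : nat} a (S : 'M[R]_n) u v :
  bform S u (a *: v) = a * bform S u v.
Proof. by rewrite /bform -scalemxAr mxE. Qed.

Lemma bform1E {R : realType} {n : nat} (u : 'cV[R]_n) :
  bform 1%:M u u = \sum_i u i 0 ^+ 2.
Proof.
by rewrite /bform mulmx1 mxE; apply: eq_bigr => i _; rewrite mxE expr2.
Qed.

Lemma bform1_ge0 {R : realType} {n : nat} (u : 'cV[R]_n) :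
  0 <= bform 1%:M u u.
Proof. by rewrite bform1E sumr_ge0// => i _; rewrite sqr_ge0. Qed.

Lemma bform1_gt0 {R : realType} {n : nat} (u : 'cV[R]_n) :
  u != 0 -> 0 < bform 1%:M u u.
Proof.
move=> u0; rewrite lt_neqAle bform1_ge0 andbT eq_sym.
apply: contra u0; rewrite bform1E psumr_eq0 => [/allP h|i _]; last exact: sqr_ge0.
apply/eqP/matrixP => i j; rewrite ord1 mxE.
by have := h i (mem_index_enum i); rewrite sqrf_eq0 => /eqP.
Qed.

(** Termwise, from u_i u_j <= (u_i^2 + u_j^2) / 2 <= |u|^2. *)
Lemma bform_le {R : realType} {n : nat} (S : 'M[R]_n) (u : 'cV[R]_n) :
  bform S u u <= (\sum_i \sum_j `|S i j|) * bform 1%:M u u.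
Proof.
have coord_le i : u i 0 ^+ 2 <= bform 1%:M u u.
  by rewrite bform1E (bigD1 i)//= lerDl sumr_ge0// => j _; rewrite sqr_ge0.
have -> : bform S u u = \sum_i \sum_j u i 0 * S i j * u j 0.
  rewrite /bform mxE exchange_big; apply: eq_bigr => j _.
  by rewrite mxE mulr_suml; apply: eq_bigr => i _; rewrite mxE.
rewrite mulr_suml; apply: ler_sum => i _.
rewrite mulr_suml; apply: ler_sum => j _.
apply: (le_trans (ler_norm _)); rewrite !normrM mulrAC mulrC.
apply: ler_wpM2l => //.
have := coord_le i; have := coord_le j.
rewrite -(real_normK (num_real (u i 0))) -(real_normK (num_real (u j 0))).
have := sqr_ge0 (`|u i 0| - `|u j 0|); nra.
Qed.

(** * Smallest eigenvalue of a symmetric matrix *)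

Lemma psdmx_scale {R : realType} {n : nat} (s : R) (X : 'M[R]_n) :
  0 <= s -> psdmx X -> psdmx (s *: X).
Proof.
move=> s0 [sX pX]; split.
  by have := symmetricmx_affine s 0 sX; rewrite (_ : 0%:M = 0) ?add0r// raddf0.
by move=> u; rewrite -/(bform _ u u) bformZS mulr_ge0 ?pX.
Qed.

Lemma psdmx_shiftP {R : realType} {n : nat} (X : 'M[R]_n) (t : R) :
  X \is symmetricmx ->
  psdmx (X - t%:M) <-> forall u, t * bform 1%:M u u <= bform X u u.
Proof.
move=> sX; split=> [[_ h] u|h].
  by have := h u; rewrite -/(bform _ u u) bform_shift subr_ge0.
split=> [|u]; last by rewrite -/(bform _ u u) bform_shift subr_ge0.
by have := symmetricmx_affine 1 (- t) sX; rewrite scale1r raddfN addrC.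
Qed.

(** An inverse bounded by K forces S >= K^-1: expanding the nonnegative value
    of S at u - K^-1 S^-1 u gives
      S(u,u) - 2 K^-1 |u|^2 + K^-2 S^-1(u,u) >= 0,
    and the last term is at most K^-1 |u|^2. This replaces the compactness of
    the unit sphere in the proof that the best shift of a symmetric matrix is
    attained at a singular matrix. *)
Lemma psdmx_shift_unit {R : realType} {n : nat} (S : 'M[R]_n) :
  psdmx S -> S \in unitmx -> exists2 e : R, 0 < e & psdmx (S - e%:M).
Proof.
move=> [sS pS] uS.
(* Adding 1 keeps K positive even when the sum of entries vanishes (n = 0). *)
pose K := 1 + \sum_i \sum_j `|invmx S i j|.
have K0 : 0 < K.
  by rewrite ltr_pwDl ?ltr01// sumr_ge0// => i _; rewrite sumr_ge0.
exists K^-1; first by rewrite invr_gt0.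
apply/(psdmx_shiftP _ sS) => u.
set v := invmx S *m u.
have Sv : S *m v = u by rewrite mulmxA mulmxV// mul1mx.
have symS : S^T = S by exact/symmetricmxP.
have Suv : bform S u v = bform 1%:M u u.
  by rewrite /bform -mulmxA Sv mulmx1.
have Svu : bform S v u = bform 1%:M u u.
  by rewrite /bform -[in v^T *m S]symS -trmx_mul Sv mulmx1.
have Svv : bform S v v = bform (invmx S) u u.
  by rewrite /bform -[in v^T *m S]symS -trmx_mul Sv -mulmxA.
have := pS (u + (- K^-1) *: v).
rewrite -/(bform _ _ _) !(bformDl, bformDr, bformZl, bformZr) Suv Svu Svv.
have := bform_le (invmx S) u; have := bform1_ge0 u.
set q := bform 1%:M u u; set w := bform (invmx S) u u => q0 wq.
have {}wq : w <= K * q.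
  by rewrite /K mulrDl mul1r; apply: le_trans wq _; rewrite lerDr.
have : K^-1 * (K^-1 * w) <= K^-1 * q.
  by apply: ler_wpM2l; [rewrite invr_ge0 ltW|rewrite ler_pdivrMl].
lra.
Qed.

(** The set of t with X - t I positive semidefinite has a largest element mu,
    and X - mu I is singular, since otherwise [psdmx_shift_unit] would allow a
    larger shift: mu is an eigenvalue. Testing the form at an eigenvector shows
    that no eigenvalue is smaller. *)
Lemma psdmx_lambda_min {R : realType} {n : nat} (X : 'M[R]_n) (t : R) :
  (0 < n)%N -> X \is symmetricmx ->
  psdmx (X - t%:M) <-> t <= lambda_min X.
Proof.
move=> n0 sX.
pose T := [set t : R | psdmx (X - t%:M)].
have TP s : T s <-> _ := psdmx_shiftP s sX.
have Teig s a : T s -> eigenvalue X a -> s <= a.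
  move=> /TP Ts /eigenvalueP[v vX v0].
  have vT0 : v^T != 0 by rewrite trmx_eq0.
  have := Ts v^T; rewrite {2}/bform trmxK vX -scalemxAl mxE.
  rewrite (_ : (v *m v^T) 0 0 = bform 1%:M v^T v^T); last by rewrite /bform trmxK mulmx1.
  by rewrite ler_pM2r// bform1_gt0.
(* The entrywise bound on - X yields a first admissible shift. *)
have T0 : T !=set0.
  exists (- \sum_i \sum_j `|(- X) i j|); apply/TP => u.
  have := bform_le (- X) u; rewrite -[in bform (- X)]scaleN1r bformZS; lra.
have Tub : has_ubound T.
  pose u : 'cV[R]_n := const_mx 1.
  have q0 : 0 < bform 1%:M u u.
    apply: bform1_gt0; apply/eqP => /matrixP /(_ (Ordinal n0) 0).
    by rewrite !mxE => /eqP; rewrite oner_eq0.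
  exists (bform X u u / bform 1%:M u u) => s /TP /(_ u).
  by rewrite ler_pdivlMr.
set mu := sup T.
have Tmu : T mu.
  apply/TP => u; have [->|u0] := eqVneq u 0.
    by rewrite /bform !mulmx0 mxE mulr0.
  rewrite -ler_pdivlMr ?bform1_gt0//; apply: ge_sup => // s /TP /(_ u).
  by rewrite ler_pdivlMr ?bform1_gt0.
have sing : X - mu%:M \notin unitmx.
  apply/negP => /(psdmx_shift_unit Tmu)[e e0].
  rewrite -addrA -opprD -raddfD /= => Te.
  have : mu + e <= mu by apply: ub_le_sup.
  lra.
have eigmu : eigenvalue X mu.
  rewrite /eigenvalue /eigenspace -mxrank_eq0 mxrank_ker subn_eq0 -ltnNge.
  by rewrite ltn_neqAle rank_leq_row andbT; move: sing; rewrite -row_free_unit.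
have -> : lambda_min X = mu.
  apply/eqP; rewrite eq_le; apply/andP; split.
    by apply: ge_inf => //; exists mu => a /Teig; apply.
  by apply: lb_le_inf; [exists mu|move=> a /Teig; apply].
split=> [Tt|tmu]; first exact: ub_le_sup.
apply/TP => u; apply: le_trans ((TP mu).1 Tmu u).
by rewrite ler_wpM2r ?bform1_ge0.
Qed.

Lemma psdmx_lambda_min_ge0 {R : realType} {n : nat} (X : 'M[R]_n) :
  (0 < n)%N -> X \is symmetricmx -> psdmx X <-> 0 <= lambda_min X.
Proof.
by move=> n0 sX; rewrite -psdmx_lambda_min// raddf0 subr0.
Qed.

(** * Rays from the identity *)

Definition ray {R : realType} {n : nat} (s : R) (X : 'M[R]_n) : 'M[R]_n :=
  1%:M + s *: (X - 1%:M).

Lemma ray_sym {R : realType} {n : nat} (s : R) (X : 'M[R]_n) :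
  X \is symmetricmx -> ray s X \is symmetricmx.
Proof.
move=> sX; have := symmetricmx_affine s (1 - s) sX.
by rewrite /ray scalerBr raddfB /= scalemx1 addrA addrAC.
Qed.

Lemma ray_ray {R : realType} {n : nat} (s t : R) (X : 'M[R]_n) :
  ray s (ray t X) = ray (s * t) X.
Proof. by rewrite /ray [in s *: _]addrC addKr scalerA. Qed.

Lemma ray1 {R : realType} {n : nat} (X : 'M[R]_n) : ray 1 X = X.
Proof. by rewrite /ray scale1r addrC subrK. Qed.

Lemma mxinner_ray {R : realType} {n : nat} (C : 'M[R]_n) s X :
  mxinner C (ray s X) =
  mxinner C 1%:M - s * (mxinner C 1%:M - mxinner C X).
Proof.
rewrite /mxinner /ray mulmxDr -scalemxAr mulmxBr mxtraceD mxtraceZ linearB /=.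
ring.
Qed.

Lemma Amap_ray {R : realType} {n m : nat} (A : 'I_m -> 'M[R]_n) b s X :
  Amap A 1%:M = b -> Amap A X = b -> Amap A (ray s X) = b.
Proof.
move=> <- /rowP AX; apply/rowP => i; have := AX i.
by rewrite !mxE mxinner_ray => ->; rewrite subrr mulr0 subr0.
Qed.

Lemma lambda_min_ray {R : realType} {n : nat} (s : R) (X : 'M[R]_n) :
  (0 < n)%N -> X \is symmetricmx -> 0 < s ->
  lambda_min (ray s X) = 1 + s * (lambda_min X - 1).
Proof.
move=> n0 sX s0.
(* The two sides have the same lower bounds. *)
have H t : t <= lambda_min (ray s X) <-> t <= 1 + s * (lambda_min X - 1).
  have E : ray s X - t%:M = s *: (X - (1 + (t - 1) / s)%:M).
    apply/matrixP => i j; rewrite /ray !mxE.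
    by case: (i == j); rewrite ?mulr1n ?mulr0n; field; rewrite ?gt_eqF //.
  split.
    move/(psdmx_lambda_min _ n0 (ray_sym s sX)).
    rewrite E => /(psdmx_scale (s := s^-1)); rewrite scalerA mulVf ?gt_eqF// scale1r.
    rewrite invr_ge0 (ltW s0) => /(_ isT) /(psdmx_lambda_min _ n0 sX).
    by rewrite -lerBrDl ler_pdivrMr// mulrC -lerBlDl.
  move=> h; apply/(psdmx_lambda_min _ n0 (ray_sym s sX)).
  rewrite E; apply: psdmx_scale; first exact: ltW.
  apply/(psdmx_lambda_min _ n0 sX).
  by rewrite -lerBrDl ler_pdivrMr// mulrC lerBlDl.
by apply/eqP; rewrite eq_le; apply/andP; split; apply/H.
Qed.

(** * Feasible points on rays *)

Lemma ray_feasible {R : realType} {n m : nat} (A : 'I_m -> 'M[R]_n) b s X :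
  (0 < n)%N -> Amap A 1%:M = b -> X \is symmetricmx -> Amap A X = b ->
  0 < s -> s * (1 - lambda_min X) <= 1 -> sdp_feasible A b (ray s X).
Proof.
move=> n0 AI sX AX s0 h; split; first exact: Amap_ray.
apply/(psdmx_lambda_min_ge0 n0 (ray_sym s sX)).
by rewrite lambda_min_ray//; lra.
Qed.

(** The identity is interior to the cone, so a short enough step from it in a
    decreasing direction stays feasible; hence the identity is not optimal. *)
Lemma feasible_descent {R : realType} {n m : nat} (C : 'M[R]_n)
    (A : 'I_m -> 'M[R]_n) b X :
  (0 < n)%N -> Amap A 1%:M = b -> X \is symmetricmx -> Amap A X = b ->
  mxinner C X < mxinner C 1%:M ->
  exists2 Y, sdp_feasible A b Y & mxinner C Y < mxinner C 1%:M.
Proof.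
move=> n0 AI sX AX lt.
have d0 : 0 < 1 + `|1 - lambda_min X| by rewrite ltr_pwDl.
have s0 : 0 < (1 + `|1 - lambda_min X|)^-1 by rewrite invr_gt0.
exists (ray (1 + `|1 - lambda_min X|)^-1 X).
  apply: ray_feasible => //; rewrite ler_pdivrMl// mulr1.
  by apply: le_trans (ler_norm _) _; rewrite lerDr.
by rewrite mxinner_ray; nra.
Qed.

(** If 1 <= lambda_min X, the whole ray from I through X lies in the cone, and
    C decreases without bound along it. *)
Lemma lambda_min_lt1 {R : realType} {n m : nat} (C : 'M[R]_n)
    (A : 'I_m -> 'M[R]_n) b v X :
  (0 < n)%N -> Amap A 1%:M = b ->
  (forall Y, sdp_feasible A b Y -> v <= mxinner C Y) ->
  X \is symmetricmx -> Amap A X = b -> mxinner C X < mxinner C 1%:M ->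
  lambda_min X < 1.
Proof.
move=> n0 AI bnd sX AX lt; rewrite ltNge; apply/negP => l1.
pose d := mxinner C 1%:M - mxinner C X.
have d0 : 0 < d by rewrite subr_gt0.
(* At this step the objective has fallen below v by at least 1. *)
pose s := (1 + `|mxinner C 1%:M - v|) / d.
have s0 : 0 < s by rewrite divr_gt0// ltr_pwDl.
have /bnd : sdp_feasible A b (ray s X) by apply: ray_feasible => //; nra.
rewrite mxinner_ray divfK ?gt_eqF//.
have := ler_norm (mxinner C 1%:M - v); lra.
Qed.

Lemma Zmap_feasible {R : realType} {n m : nat} (A : 'I_m -> 'M[R]_n) b X :
  (0 < n)%N -> Amap A 1%:M = b -> X \is symmetricmx -> Amap A X = b ->
  lambda_min X < 1 -> sdp_feasible A b (Zmap X).
Proof.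
move=> n0 AI sX AX l1; apply: ray_feasible => //.
  by rewrite invr_gt0 subr_gt0.
by rewrite mulVf// subr_eq0 gt_eqF.
Qed.

Lemma mxinner_Zmap {R : realType} {n : nat} (C X : 'M[R]_n) :
  mxinner C (Zmap X) =
  mxinner C 1%:M - (mxinner C 1%:M - mxinner C X) / (1 - lambda_min X).
Proof. by rewrite mxinner_ray mulrC. Qed.

Theorem theorem2p2 (R : realType) (n m : nat) (C : 'M[R]_n)
    (A : 'I_m -> 'M[R]_n) (b : 'rV[R]_m)
    (symC : C \is symmetricmx)
    (symA : forall i : 'I_m, A i \is symmetricmx)
    (feasI : Amap A 1%:M = b)
    (C_not_orth : exists V : 'M[R]_n,
       [/\ V \is symmetricmx, Amap A V = 0 & mxinner C V <> 0])
    (opt_fin : opt_val C A b \is a fin_num)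
    (val : R) (val_lt : val < mxinner C 1%:M) :
  (forall Xs : 'M[R]_n, Pval_optimal C A b val Xs ->
     lambda_min Xs < 1 /\ sdp_optimal C A b (Zmap Xs)) /\
  (forall Zs : 'M[R]_n, sdp_optimal C A b Zs ->
     let Xs := 1%:M + ((mxinner C 1%:M - val)
                       / (mxinner C 1%:M - fine (opt_val C A b)))
                      *: (Zs - 1%:M) in
     [/\ Pval_optimal C A b val Xs, lambda_min Xs < 1 & Zs = Zmap Xs]).
Proof.
(* All inner products vanish in size 0. *)
have n0 : (0 < n)%N.
  case: n C A symC symA feasI C_not_orth opt_fin val_lt => // C' A' _ _ _ [V [_ _]].
  by rewrite /mxinner /mxtrace big_ord0.
have bnd Y : sdp_feasible A b Y -> fine (opt_val C A b) <= mxinner C Y.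
  move=> fY; rewrite -lee_fin fineK//.
  by apply: ereal_inf_lbound; exists Y.
have lt1 X : Pval_feasible C A b val X -> lambda_min X < 1.
  by move=> [sX AX CX]; apply: (lambda_min_lt1 n0 feasI bnd sX AX); rewrite CX.
split=> [Xs [fXs optXs]|Zs [fZs optZs] Xs].
  have l1 := lt1 _ fXs; split=> //; have [sXs AXs CXs] := fXs.
  split=> [|Y fY]; first exact: Zmap_feasible.
  have [AY psdY] := fY; have [sY _] := psdY.
  have lY := (psdmx_lambda_min_ge0 n0 sY).1 psdY.
  rewrite leNgt; apply/negP => ltYZ.
  have dX : 0 < 1 - lambda_min Xs by rewrite subr_gt0.
  pose c := mxinner C 1%:M; pose d := c - mxinner C Y.
  have ltd : c - val < d * (1 - lambda_min Xs).
    move: ltYZ; rewrite mxinner_Zmap CXs ltrBrDl -ltrBrDr ltr_pdivrMr//.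
  have d0 : 0 < d by rewrite -(pmulr_lgt0 _ dX) (lt_trans _ ltd)// subr_gt0.
  (* The point of level val on the ray through Y would beat Xs, since
     lambda_min Y >= 0 makes its smallest eigenvalue at least 1 - s. *)
  pose s := (c - val) / d.
  have s0 : 0 < s by rewrite divr_gt0// subr_gt0.
  have slt : s < 1 - lambda_min Xs by rewrite ltr_pdivrMr// mulrC.
  have : Pval_feasible C A b val (ray s Y).
    split; [exact: ray_sym|exact: Amap_ray|].
    by rewrite mxinner_ray divfK ?gt_eqF// opprB addrC subrK.
  by move/optXs; rewrite lambda_min_ray//; nra.
have optE : fine (opt_val C A b) = mxinner C Zs.
  apply/eqP; rewrite eq_le bnd//= -lee_fin fineK//.
  by apply: le_ereal_inf_tmp => _ [Y fY <-]; rewrite lee_fin optZs.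
set c := mxinner C 1%:M in Xs val_lt *.
have vc : fine (opt_val C A b) < c.
  have [V [sV AV CV]] := C_not_orth.
  (* The sign e makes e V a descent direction. *)
  have [e eV] : exists e : R, e * mxinner C V < 0.
    have [lt|] := ltP (mxinner C V) 0.
      by exists 1; rewrite mul1r.
    rewrite le_eqVlt eq_sym => /orP[/eqP//|gt].
    by exists (-1); rewrite mulN1r oppr_lt0.
  have CI : mxinner C (1%:M + e *: V) = c + e * mxinner C V.
    by rewrite /mxinner mulmxDr -scalemxAr mxtraceD mxtraceZ.
  have [|||Y fY ltY] := @feasible_descent R n m C A b (1%:M + e *: V) n0 feasI.
  - exact: symmetricmx_affine.
  - rewrite -feasI; apply/rowP => i; move/rowP/(_ i): AV; rewrite !mxE => AV.
    rewrite /mxinner mulmxDr -scalemxAr mxtraceD mxtraceZ.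
    by rewrite -/(mxinner _ V) AV mulr0 addr0.
  - by rewrite CI; lra.
  - exact: le_lt_trans (bnd _ fY) ltY.
have [AZ psdZ] := fZs; have [sZ _] := psdZ.
(* Were Zs interior, the exit point of its ray would have a smaller value. *)
have lZ : lambda_min Zs = 0.
  apply/eqP; rewrite eq_le (psdmx_lambda_min_ge0 n0 sZ).1// andbT.
  have l1 : lambda_min Zs < 1.
    by apply: (lambda_min_lt1 n0 feasI bnd sZ AZ); rewrite -optE.
  have := optZs _ (Zmap_feasible n0 feasI sZ AZ l1).
  rewrite mxinner_Zmap -/c lerBrDl -lerBrDr ler_pdivrMr ?subr_gt0//.
  by rewrite -subr_ge0 -optE; nra.
have dv : 0 < c - fine (opt_val C A b) by rewrite subr_gt0.
pose s := (c - val) / (c - fine (opt_val C A b)).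
have s0 : 0 < s by rewrite divr_gt0// subr_gt0.
have lXs : lambda_min Xs = 1 - s.
  by rewrite (lambda_min_ray n0 sZ s0) lZ sub0r mulrN1.
have fXs : Pval_feasible C A b val Xs.
  split; [exact: ray_sym|exact: Amap_ray|].
  by rewrite mxinner_ray -optE -/c divfK ?gt_eqF// opprB addrC subrK.
split.
- split=> // Y fY; have [sY AY CY] := fY.
  have lY := lt1 _ fY.
  have := bnd _ (Zmap_feasible n0 feasI sY AY lY).
  rewrite mxinner_Zmap CY -/c lXs lerBrDl -lerBrDr ler_pdivrMr ?subr_gt0// => h.
  have : s <= 1 - lambda_min Y by rewrite ler_pdivrMr// mulrC.
  lra.
- by rewrite lXs; lra.
- rewrite /Zmap -/(ray _ Xs) ray_ray lXs opprB addrC subrK mulVf ?gt_eqF//.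
  by rewrite ray1.
Qed.
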